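(* Let $(X,w,\mu)$ be a locally finite weighted graph and let $d=d_\sigma$ be an intrinsic path metric. If the upper Minkowski codimension of the Cauchy boundary satisfies $\overline{\mathrm{codim}}_M(\partial_CX)>2$, then $\partial_CX$ is polar.
   Context: All functions are real valued. A weighted graph $(X,w,\mu)$ consists of a countably infinite discrete set $X$, a function $\mu:X\to(0,\infty)$ (viewed as a measure on $X$), and a symmetric function $w:X\times X\to[0,\infty)$ with $w(x,x)=0$ and $\sum_{y\in X}w(x,y)<\infty$ for all $x\in X$. Write $x\sim y$ ($x,y$ are neighbors) if $w(x,y)>0$. The graph is locally finite if every vertex has only finitely many neighbors. A path connecting $x$ and $y$ is a sequence $(x_0,\dots,x_n)$, $n\ge1$, with $x_0=x$, $x_n=y$, $x_i\sim x_{i+1}$. All weighted graphs are assumed connected: any two distinct points are connected by a path. Let $\sigma:X\times X\to[0,\infty)$ be symmetric with $\sigma(x,y)>0$ if and only if $x\sim y$. The path pseudo metric $d_\sigma$ is given by $d_\sigma(x,x)=0$ and, for $x\ne y$, $d_\sigma(x,y)=\inf l_\sigma((x_0,\dots,x_n))$ over all paths connecting $x$ and $y$, where $l_\sigma((x_0,\dots,x_n))=\sum_{i=0}^{n-1}\sigma(x_i,x_{i+1})$. On a locally finite graph this is a metric inducing the discrete topology. A pseudo metric $d$ is intrinsic if $\frac1{\mu(x)}\sum_{y}w(x,y)d(x,y)^2\le1$ for all $x\in X$. $L^2(X,\mu)$ has norm $\|u\|=(\sum_xu(x)^2\mu(x))^{1/2}$. For $f:X\to\mathbb R$ let $\widetilde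 Q(f)=\frac12\sum_{x,y\in X}w(x,y)(f(x)-f(y))^2\in[0,\infty]$, $\|f\|_{\widetilde Q}=(\widetilde Q(f)+\|f\|^2)^{1/2}$, and $D(Q^{\max})=\{f\in L^2(X,\mu)\mid\widetilde Q(f)<\infty\}$. For $U\subseteq X$ put $\mathrm{Cap}(U)=\inf\{\|u\|_{\widetilde Q}\mid u\in D(Q^{\max}),\ 1_U\le u\}$, with $\inf\emptyset=\infty$. Let $(\overline X,\overline d)$ be the metric completion of $(X,d)$ and $\partial_CX=\overline X\setminus X$ the Cauchy boundary. For $A\subseteq\overline X$ put $\mathrm{Cap}(A)=\inf\{\mathrm{Cap}(O\cap X)\mid A\subseteq O,\ O\subseteq\overline X\text{ open}\}$. $\partial_CX$ is polar if $\mathrm{Cap}(\partial_CX)=0$. The upper Minkowski codimension is $\overline{\mathrm{codim}}_M(\partial_CX)=\limsup_{r\to0}\frac{\ln\mu(B_r(\partial_CX))}{\ln r}$, where $B_r(\partial_CX)=\{x\in X\mid\inf_{b\in\partial_CX}\overline d(x,b)\le r\}$ and $\mu(B)=\sum_{x\in B}\mu(x)$. *)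

(* Defs.v *)
From mathcomp Require Import all_boot all_order all_algebra.
From mathcomp Require Import all_classical all_reals all_analysis.

Set Implicit Arguments.
Unset Strict Implicit.
Unset Printing Implicit Defensive.

Import Order.TTheory GRing.Theory Num.Theory.
Import numFieldNormedType.Exports.

Local Open Scope classical_set_scope.
Local Open Scope ring_scope.

(* [path_between e x y p]: the nonempty list p = [x_1; ...; x_n] encodes the
   path (x, x_1, ..., x_n), n >= 1, of e-neighbors from x to x_n = y. *)
Definition path_between (X : choiceType) (e : rel X) (x y : X) (p : seq X) :=
  [/\ p <> [::], path e x p & last x p = y].

Record weighted_graph (R : realType) (X : choiceType) := WeightedGraph {
  wgt : X -> X -> R;
  vol : X -> R;
  wg_countably_infinite : ([set: X] #= [set: nat])%card;
  wg_vol_gt0 : forall x, 0 < vol x;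
  wg_wgt_ge0 : forall x y, 0 <= wgt x y;
  wg_wgt_sym : forall x y, wgt x y = wgt y x;
  wg_wgt_diag : forall x, wgt x x = 0;
  wg_wgt_sum : forall x, (\esum_(y in [set: X]) (wgt x y)%:E < +oo)%E;
  wg_connected : forall x y, x <> y ->
    exists p, path_between (fun a b => 0 < wgt a b) x y p
}.

Section weighted_graphs.
Variables (R : realType) (X : choiceType) (G : weighted_graph R X).

Definition neighbor : rel X := fun x y => 0 < wgt G x y.

Definition locally_finite := forall x, finite_set [set y | neighbor x y].

Definition edge_length (sigma : X -> X -> R) :=
  [/\ forall x y, 0 <= sigma x y,
      forall x y, sigma x y = sigma y x &
      forall x y, 0 < sigma x y <-> neighbor x y].

Definition path_length (sigma : X -> X -> R) (x : X) (p : seq X) : R :=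
  \sum_(i < size p) sigma (nth x (x :: p) i) (nth x (x :: p) i.+1).

Definition path_dist (sigma : X -> X -> R) (x y : X) : R :=
  if x == y then 0
  else inf [set path_length sigma x p | p in path_between neighbor x y].

Definition intrinsic (d : X -> X -> R) := forall x,
  (((vol G x)^-1)%:E *
     (\esum_(y in [set: X]) (wgt G x y * d x y ^+ 2)%:E) <= 1)%E.

Definition measure_of (B : set X) : \bar R := (\esum_(x in B) (vol G x)%:E)%E.

Definition L2norm (u : X -> R) : \bar R :=
  sqrte (\esum_(x in [set: X]) (u x ^+ 2 * vol G x)%:E)%E.

Definition energy (f : X -> R) : \bar R :=
  ((2^-1)%:E * (\esum_(p in [set: X * X])
                  (wgt G p.1 p.2 * (f p.1 - f p.2) ^+ 2)%:E))%E.

Definition energy_norm (f : X -> R) : \bar R :=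
  sqrte (energy f + L2norm f ^+ 2)%E.

Definition dom_Qmax : set (X -> R) :=
  [set f | (L2norm f < +oo)%E /\ (energy f < +oo)%E].

Definition cap (U : set X) : \bar R :=
  ereal_inf [set energy_norm u | u in
    [set u | dom_Qmax u /\ forall x, \1_U x <= u x]].

Section completion.
Variables (Y : metricType R) (iota : X -> Y).

(* Y together with iota is a metric completion of (X, d); the completion is
   determined only up to isometry, and X is identified with its image under
   iota. *)
Definition metric_completion (d : X -> X -> R) :=
  [/\ forall x y, mdist (iota x) (iota y) = d x y,
      dense (range iota) &
      forall u : nat -> Y, cauchy (u @ \oo) -> exists l : Y, u @ \oo --> l].

Definition cauchy_boundary : set Y := ~` range iota.

Definition capY (A : set Y) : \bar R :=
  ereal_inf [set cap (iota @^-1` O) | O in [set O | A `<=` O /\ open O]].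

Definition polar (A : set Y) := capY A = 0%E.

Definition neighborhood (A : set Y) (r : R) : set X :=
  [set x | (ereal_inf [set (mdist (iota x) b)%:E | b in A] <= r%:E)%E].

(* Extended-real conventions: ln 0 = -oo and ln +oo = +oo. For 0 < r < 1 the
   quotient is thus +oo when the neighborhood is empty (in particular for
   A = set0) and -oo when it has infinite measure. *)
Definition upper_codim (A : set Y) : \bar R :=
  limf_esup (fun r : R => (lne (measure_of (neighborhood A r)) / (ln r)%:E)%E)
    0^'+.

End completion.
End weighted_graphs.

(* Main.v *)
Require Import Defs.
From mathcomp Require Import all_boot all_order all_algebra.
From mathcomp Require Import all_classical all_reals all_analysis.
From mathcomp Require Import ring lra.

(* Let D be the distance to the Cauchy boundary and B_r = {D <= r}. The cutoff
   u = max(0, 2 (1 - D/r)) is at least 1 on {D < r/2}, vanishes off B_r, and is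
   2/r-Lipschitz with values in [0, 2]. An edge contributes to the energy of u
   only if one of its endpoints lies in B_r, so for an intrinsic metric the
   energy is at most (2/r)^2 mu(B_r), and Cap(boundary)^2 <= 8 mu(B_r) / r^2
   for r < 1. If the upper codimension exceeds 2, then mu(B_r) <= r^b with some
   fixed b > 2 for arbitrarily small r, which makes this bound as small as
   desired. *)

Set Implicit Arguments.
Unset Strict Implicit.
Unset Printing Implicit Defensive.

Import Order.TTheory GRing.Theory Num.Theory.
Import numFieldNormedType.Exports.
Local Open Scope classical_set_scope.
Local Open Scope ring_scope.

(** * Weighted sums, and measure decay from an upper limit *)

Lemma esumZl_le (R : realType) (T : choiceType) (I : set T) (c : R)
    (a : T -> \bar R) : (forall i, 0 <= a i)%E -> 0 <= c ->
  (\esum_(i in I) (c%:E * a i) <= c%:E * \esum_(i in I) a i)%E.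
Proof.
move=> a0 c0; apply: ge_ereal_sup => _ [F IF <-].
rewrite -ge0_mule_fsumr//; apply: lee_wpmul2l; first by rewrite lee_fin.
by apply: ereal_sup_ubound; exists F.
Qed.

(** Pick [b] strictly between [a] and the upper limit. Some small [r] has ratio above [b]; since
    [ln r < 0], this means [m r <= r^b = r^(b - a) * r^a], and the factor [r^(b - a)] tends to 0. *)
Lemma limf_esup_lne_ratio (R : realType) (m : R -> \bar R) (a e : R) :
  (forall r, 0 <= m r)%E -> 0 < e ->
  (a%:E < limf_esup (fun r => lne (m r) / (ln r)%:E) 0^'+)%E ->
  exists r, [/\ 0 < r, r < 1 & (m r <= (e * r `^ a)%:E)%E].
Proof.
move=> m0 e0 alt.
have [b ab blt] : exists2 b : R, a < b &
    (b%:E < limf_esup (fun r => lne (m r) / (ln r)%:E) 0^'+)%E.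
  case: (limf_esup _ _) alt => [s||//]; last first.
    by exists (a + 1); rewrite ?ltrDl// ltry.
  rewrite lte_fin => /midf_lt as_; exists ((a + s) / 2); first by case: as_.
  by rewrite lte_fin; case: as_.
have pw : \forall r \near (0 : R)^'+, `|r `^ (b - a)| < e.
  have ba : 0 < b - a by rewrite subr_gt0.
  exact: (cvgr0_norm_lt _ (powR_cvg0 ba)).
pose V := [set r : R | [/\ 0 < r, r < 1 & `|r `^ (b - a)| < e]].
have VF : (0 : R)^'+ V.
  by near=> r; split; near: r;
    [exact: nbhs_right_gt|exact: nbhs_right_lt|exact: pw].
(* The upper limit is the infimum, over the sets of the filter, of the suprema of the ratio, so the
   supremum over [V] exceeds [b] and some [r] in [V] has ratio above [b]. *)
have /ereal_sup_gt[_ [r [r0 r1 re] <-] br] :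
    (b%:E < ereal_sup [set lne (m r) / (ln r)%:E | r in V])%E.
  by apply: lt_le_trans blt _; apply: ereal_inf_lbound; exists V.
exists r; split=> //.
have lnr0 : ln r < 0 by rewrite ln_lt0// r0.
have rbea : r `^ b <= e * r `^ a.
  rewrite -[X in r `^ X](subrK a) powRD; last by rewrite (gt_eqF r0) implybT.
  by rewrite ler_wpM2r ?powR_ge0// ltW// (le_lt_trans (ler_norm _) re).
apply: (@le_trans _ _ (r `^ b)%:E); last by rewrite lee_fin.
(* An infinite [m r] would make the ratio -oo, which is not above [b]. A zero [m r] is split off
   because its logarithm is -oo; the bound is then trivial. *)
move: br (m0 r); case: (m r) => [s|/=|//]; last first.
  by rewrite inver (lt_eqF lnr0) mulyr ltr0_sg ?invr_lt0// EFinN mulN1e.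
rewrite lee_fin le_eqVlt => + /predU1P[<-|s0]; first by rewrite lee_fin powR_ge0.
rewrite lne_EFin// inver (lt_eqF lnr0) -EFinM lte_fin ltr_ndivlMr// -ln_powR.
by rewrite ltr_ln ?posrE ?powR_gt0// lee_fin => /ltW.
Unshelve. all: by end_near. Qed.

(** * Energy, norm and capacity bounds for Lipschitz cutoffs *)

Section intrinsic_cutoff.
Variables (R : realType) (X : choiceType) (G : weighted_graph R X).

(** Each contributing pair is charged to an endpoint in [B]. The charges at [x] sum to at most
    [L ^+ 2 * vol G x] by intrinsicness, and charging either endpoint costs a factor 2 that cancels
    the 1/2 in the energy. *)
Lemma energy_lipschitz_le (d : X -> X -> R) (B : set X) (u : X -> R) (L : R) :
  intrinsic G d -> (forall x y, d x y = d y x) ->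
  (forall x y, `|u x - u y| <= L * d x y) -> (forall x, ~ B x -> u x = 0) ->
  (energy G u <= (L ^+ 2)%:E * measure_of G B)%E.
Proof.
move=> hd dC uL uB.
(* [g] is the charge to the first endpoint; [g (sw p)] is the charge to the second and has the same
   total. *)
pose g (p : X * X) := if p.1 \in B then
  ((L ^+ 2)%:E * (wgt G p.1 p.2 * d p.1 p.2 ^+ 2)%:E)%E else 0%E.
have w0 x y : 0 <= wgt G x y * d x y ^+ 2 by rewrite mulr_ge0 ?wg_wgt_ge0 ?sqr_ge0.
have g0 p : (0 <= g p)%E.
  by rewrite /g; case: ifP => // _; rewrite mule_ge0// lee_fin ?sqr_ge0.
pose sw (p : X * X) := (p.2, p.1).
have swE : (\esum_(p in [set: X * X]) g (sw p) = \esum_(p in [set: X * X]) g p)%E.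
  rewrite [RHS](reindex_esum setT setT sw)//; split=> //.
    by move=> [a b] [a' b'] _ _ [-> ->].
  by move=> [a b] _; exists (b, a).
have gB : (\esum_(p in [set: X * X]) g p <= (L ^+ 2)%:E * measure_of G B)%E.
  have -> : [set: X * X] = [set: X] `*`` (fun=> [set: X]) by apply/seteqP; split.
  rewrite (_ : g = fun p => g (p.1, p.2)); last by apply/funext => -[].
  rewrite -(@esum_esum _ _ _ _ _ (fun x y => g (x, y)))//.
  apply: le_trans (esumZl_le _ _ (sqr_ge0 L)); last first.
    by move=> x; rewrite lee_fin ltW// wg_vol_gt0.
  rewrite [leRHS]esum_mkcond; apply: le_esum => x _; rewrite /g/=.
  case: ifP => xB; last by rewrite esum1.
  apply: (le_trans (esumZl_le _ _ (sqr_ge0 L))).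
    by move=> y; rewrite lee_fin.
  apply: lee_wpmul2l; first by rewrite lee_fin sqr_ge0.
  by have := hd x; rewrite lee_pdivrMl ?wg_vol_gt0// mule1.
have fg p : ((wgt G p.1 p.2 * (u p.1 - u p.2) ^+ 2)%:E <= g p + g (sw p))%E.
  case: p => x y; rewrite /=.
  have uxy : ((wgt G x y * (u x - u y) ^+ 2)%:E <=
      (L ^+ 2)%:E * (wgt G x y * d x y ^+ 2)%:E)%E.
    rewrite -EFinM lee_fin [leRHS]mulrCA -exprMn ler_wpM2l ?wg_wgt_ge0//.
    by rewrite -[leLHS]real_normK ?num_real// lerXn2r ?nnegrE// (le_trans _ (uL x y)).
  have [xB|xB] := boolP (x \in B).
    by apply: (@le_trans _ _ (g (x, y))); [rewrite /g/= xB|rewrite leeDl].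
  have [yB|yB] := boolP (y \in B).
    apply: (@le_trans _ _ (g (y, x))); last by rewrite leeDr.
    by rewrite /g/= yB wg_wgt_sym dC wg_wgt_sym.
  move: xB yB; rewrite !notin_setE => xB yB.
  by rewrite !uB// subrr expr0n mulr0 adde_ge0.
rewrite /energy lee_pdivrMl//.
apply: (@le_trans _ _ (\esum_(p in [set: X * X]) (g p + g (sw p)))%E).
  exact: le_esum.
by rewrite esumD// swE mule_natl mule2n leeD.
Qed.

Lemma L2norm_bounded_le (B : set X) (u : X -> R) (M : R) :
  (forall x, `|u x| <= M) -> (forall x, ~ B x -> u x = 0) ->
  (L2norm G u ^+ 2 <= (M ^+ 2)%:E * measure_of G B)%E.
Proof.
move=> uM uB; rewrite /L2norm sqr_sqrte; last first.
  by apply: esum_ge0 => x _; rewrite lee_fin mulr_ge0 ?sqr_ge0// ltW// wg_vol_gt0.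
apply: le_trans (esumZl_le _ _ (sqr_ge0 M)); last first.
  by move=> x; rewrite lee_fin ltW// wg_vol_gt0.
rewrite [leRHS]esum_mkcond; apply: le_esum => x _.
case: ifPn => xB.
  rewrite -EFinM lee_fin ler_wpM2r ?(ltW (wg_vol_gt0 _ _))//.
  by rewrite -[leLHS]real_normK ?num_real// lerXn2r ?nnegrE// (le_trans _ (uM x)).
by move: xB; rewrite notin_setE => xB; rewrite uB// expr0n mul0r.
Qed.

Lemma cap_ge0 (U : set X) : (0 <= cap G U)%E.
Proof. by apply: le_ereal_inf_tmp => _ [u _ <-]; exact: sqrte_ge0. Qed.

Lemma cap_lipschitz_le (d : X -> X -> R) (U B : set X) (u : X -> R) (L M : R) :
  intrinsic G d -> (forall x y, d x y = d y x) ->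
  (forall x y, `|u x - u y| <= L * d x y) -> (forall x, `|u x| <= M) ->
  (forall x, ~ B x -> u x = 0) -> (forall x, \1_U x <= u x) ->
  (measure_of G B < +oo)%E ->
  (cap G U <= sqrte ((L ^+ 2 + M ^+ 2)%:E * measure_of G B))%E.
Proof.
move=> hd dC uL uM uB Uu Bfin.
have B0 : (0 <= measure_of G B)%E.
  by apply: esum_ge0 => x _; rewrite lee_fin ltW// wg_vol_gt0.
have Eu := energy_lipschitz_le hd dC uL uB.
have Nu := L2norm_bounded_le uM uB.
have cB (c : R) : ((c ^+ 2)%:E * measure_of G B < +oo)%E.
  by rewrite lte_mul_pinfty// lee_fin sqr_ge0.
apply: ge_ereal_inf; exists (energy_norm G u).
  exists u => //; split=> //; split; last exact: le_lt_trans Eu _.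
  (* Only the square of the norm is bounded so far; an infinite norm would have an infinite
     square. *)
  rewrite ltNge leye_eq; apply/negP => /eqP Ny.
  by have := le_lt_trans Nu (cB M); rewrite Ny expeS mulyy.
rewrite /energy_norm lee_sqrt; last by rewrite mule_ge0// lee_fin addr_ge0 ?sqr_ge0.
by rewrite EFinD ge0_muleDl ?lee_fin ?sqr_ge0// leeD.
Qed.

End intrinsic_cutoff.

(** * Distance to a set in the completion *)

Section distance_to_set.
Variables (R : realType) (Y : metricType R) (A : set Y).

(** Real valued, so that cutoffs can be built from it. It matches the extended infimum in
    [neighborhood] only for nonempty [A]: over the empty set one is 0 and the other +oo. *)
Definition dist_to (y : Y) : R := inf [set mdist y b | b in A].

Lemma dist_to_le (y b : Y) : A b -> dist_to y <= mdist y b.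
Proof.
move=> Ab; apply: ge_inf; last by exists b.
by exists 0 => _ [c _ <-]; exact: mdist_ge0.
Qed.

Hypothesis A0 : A !=set0.

Lemma dist_to_ge0 (y : Y) : 0 <= dist_to y.
Proof.
case: A0 => b Ab; apply: lb_le_inf; first by exists (mdist y b), b.
by move=> _ [c _ <-]; exact: mdist_ge0.
Qed.

Lemma dist_to_lipschitz (y z : Y) : `|dist_to y - dist_to z| <= mdist y z.
Proof.
have le y' z' : dist_to y' - dist_to z' <= mdist y' z'.
  rewrite lerBlDr -lerBlDl; case: A0 => b Ab.
  apply: lb_le_inf; first by exists (mdist z' b), b.
  move=> _ [c Ac <-]; rewrite lerBlDl (le_trans (dist_to_le y' Ac))//.
  exact: metric_triangle.
by rewrite ler_norml le andbT lerNl opprB metric_sym le.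
Qed.

Lemma neighborhoodE (X : choiceType) (iota : X -> Y) (r : R) :
  neighborhood iota A r = [set x | dist_to (iota x) <= r].
Proof.
have E x : (ereal_inf [set (mdist (iota x) b)%:E | b in A] =
    (dist_to (iota x))%:E)%E.
  rewrite -ereal_inf_EFin; last 2 first.
  - by exists 0 => _ [c _ <-]; exact: mdist_ge0.
  - by case: A0 => b Ab; exists (mdist (iota x) b), b.
  by congr ereal_inf; rewrite image_comp.
by apply/seteqP; split=> x; rewrite /neighborhood/= E lee_fin.
Qed.

End distance_to_set.

(** * Capacity of the boundary *)

Lemma cap_set0 (R : realType) (X : choiceType) (G : weighted_graph R X) :
  cap G set0 = 0%E.
Proof.
have L0 : L2norm G (cst 0) = 0%E.
  by rewrite /L2norm esum1 ?sqrte0// => x _; rewrite expr0n mul0r.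
have E0 : energy G (cst 0) = 0%E.
  by rewrite /energy esum1 ?mule0// => p _; rewrite subrr expr0n mulr0.
apply/eqP; rewrite eq_le cap_ge0 andbT.
apply: ge_ereal_inf; exists 0%E => //; exists (cst 0).
  by split; [split; rewrite ?L0 ?E0|move=> x; rewrite indic0].
by rewrite /energy_norm L0 E0 expe2 mule0 adde0 sqrte0.
Qed.

Lemma capY_neighborhood_le (R : realType) (X : choiceType)
    (G : weighted_graph R X) (Y : metricType R) (iota : X -> Y) (A : set Y)
    (r : R) :
  intrinsic G (fun x y => mdist (iota x) (iota y)) -> A !=set0 -> 0 < r < 1 ->
  (measure_of G (neighborhood iota A r) < +oo)%E ->
  (capY G iota A <=
    sqrte ((8 / r ^+ 2)%:E * measure_of G (neighborhood iota A r)))%E.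
Proof.
move=> hd A0 /andP[r0 r1] fin.
(* Radius [r / 2] is where the cutoff is still at least 1; taking the interior makes [O] open. *)
pose O := (\bigcup_(b in A) ball b (r / 2))°.
have AO : A `<=` O.
  move=> b Ab; apply: (@filterS _ _ _ (ball b (r / 2))).
    by move=> y yb; exists b.
  by apply: nbhsx_ballx; rewrite divr_gt0.
apply: (@le_trans _ _ (cap G (iota @^-1` O))).
  by apply: ereal_inf_lbound; exists O => //; split=> //; exact: open_interior.
pose D x := dist_to A (iota x).
pose u x := Num.max 0 (2 * (1 - D x / r)).
have D0 x : 0 <= D x by exact: dist_to_ge0.
have u0 x : 0 <= u x by rewrite le_max lexx.
have u2 x : u x <= 2.
  by rewrite ge_max ler0n ler_piMr// gerBl divr_ge0// ltW.
(* The Lipschitz constant and the sup bound are both taken to be [2 / r]; the latter is valid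
   because [u <= 2] and [r < 1]. *)
rewrite (_ : 8 / r ^+ 2 = (2 / r) ^+ 2 + (2 / r) ^+ 2); last first.
  by rewrite expr_div_n -mulrDl -natrX -natrD.
apply: (cap_lipschitz_le (u := u) hd) fin.
- by move=> x y; exact: metric_sym.
- move=> x y.
  have -> : 2 / r * mdist (iota x) (iota y) = 2 * (mdist (iota x) (iota y) / r).
    by rewrite mulrAC mulrA.
  have : `|(D x - D y) / r| <= mdist (iota x) (iota y) / r.
    rewrite normf_div (gtr0_norm r0) ler_pM2r ?invr_gt0//.
    exact: dist_to_lipschitz.
  rewrite mulrBl ler_norml => /andP[].
  set a := D x / r; set b := D y / r; set c := mdist _ _ / r => lb ub.
  rewrite ler_norml /u -/a -/b.
  by case: (ltP 0 (2 * (1 - a))) => ?; case: (ltP 0 (2 * (1 - b))) => ?;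
    apply/andP; split; lra.
- move=> x; rewrite ger0_norm// (le_trans (u2 x))// ler_pdivlMr// ler_piMr//.
  exact: ltW.
- move=> x; rewrite neighborhoodE//= => /negP; rewrite -ltNge => rD.
  apply/max_idPl; rewrite pmulr_rle0// subr_le0 ler_pdivlMr// mul1r.
  exact: ltW.
- move=> x; rewrite indicE; have [|_] := boolP (x \in _); last exact: u0.
  rewrite inE => /interior_subset[b Ab]; rewrite ballEmdist/= metric_sym => bx.
  rewrite le_max; apply/orP; right.
  have : D x / r < 2^-1.
    by rewrite ltr_pdivrMr// mulrC (le_lt_trans (dist_to_le _ Ab)).
  lra.
Qed.

Theorem theorem4 (R : realType) (X : choiceType) (G : weighted_graph R X)
    (sigma : X -> X -> R) (Y : metricType R) (iota : X -> Y)
    (hfin : locally_finite G)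
    (hsigma : edge_length G sigma)
    (hintr : intrinsic G (path_dist G sigma))
    (hcompl : metric_completion iota (path_dist G sigma))
    (hcodim : (2%:E < upper_codim G iota (cauchy_boundary iota))%E) :
  polar G iota (cauchy_boundary iota).
Proof.
case: hcompl => dE _ _; move: hcodim; rewrite /polar.
set A := cauchy_boundary iota => hcodim.
have hd : intrinsic G (fun x y => mdist (iota x) (iota y)).
  rewrite (_ : (fun _ _ => _) = path_dist G sigma)//.
  by apply/funext => x; apply/funext => y.
have m0 r : (0 <= measure_of G (neighborhood iota A r))%E.
  by apply: esum_ge0 => x _; rewrite lee_fin ltW// wg_vol_gt0.
have cap0 : (0 <= capY G iota A)%E.
  by apply: le_ereal_inf_tmp => _ [U _ <-]; exact: cap_ge0.
apply/eqP; rewrite eq_le cap0 andbT.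
(* With an empty boundary there is no distance function, but the empty open set covers it and has
   capacity 0. *)
have [A0|/set0P A0] := eqVneq A set0.
  apply: ge_ereal_inf; exists 0%E => //; exists set0.
    by split; [rewrite A0|exact: open0].
  by rewrite preimage_set0 cap_set0.
apply/lee_addgt0Pr => e e0; rewrite add0e.
(* A single radius suffices for each [e]. The constant is chosen so that [8 / r ^+ 2] times
   [e ^+ 2 / 8 * r ^+ 2] is exactly [e ^+ 2]. *)
have e8 : 0 < e ^+ 2 / 8 by rewrite divr_gt0 ?exprn_gt0.
have [r [r0 r1 mr]] := limf_esup_lne_ratio m0 e8 hcodim.
have mfin := le_lt_trans mr (ltry _).
apply: le_trans (capY_neighborhood_le hd A0 _ mfin) _; first by rewrite r0.
have -> : e%:E = sqrte (e ^+ 2)%:E by rewrite /= sqrtr_sqr gtr0_norm.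
rewrite lee_sqrt ?lee_fin ?sqr_ge0//.
apply: le_trans (lee_wpmul2l _ mr) _; first by rewrite lee_fin divr_ge0 ?sqr_ge0.
rewrite -EFinM lee_fin powR_mulrn ?(ltW r0)// le_eqVlt; apply/orP; left.
by apply/eqP; field; rewrite gt_eqF.
Qed.
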